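(* For every $d>0$, $p\in(0,1]$ and $\rho\in(0,1]$, the one-dimensional problem described in the context is indexable; that is, for all $0\le W_1\le W_2$ one has $D(W_1)\subseteq D(W_2)$, where $D(W)$ is the set of states in which the passive action is optimal for the one-dimensional problem with parameter $W$.
   Context: $\mathbb{N}=\{0,1,2,\dots\}$. The one-dimensional problem with parameter $W\ge 0$ is the average-cost problem $$\min_{\phi\in\Phi}\ \limsup_{T\to+\infty}\frac1T\,\mathbb{E}^{\phi}\Big(\sum_{t=0}^{T-1}\big(s^{\phi}(t)+W a^{\phi}(t)\big)\,\Big|\,s(0)\Big)$$ for the following Markov decision process. States: $b^j=dp\,\frac{j(j+1)}{2}$, $j\in\mathbb{N}$. Actions: $a(t)\in\{0,1\}$ ($1$ = active, $0$ = passive). Transitions: from $b^j$ under action $0$ the next state is $b^{j+1}$ with probability $1$; under action $1$ the next state is $b^0$ with probability $\rho$ and $b^{j+1}$ with probability $1-\rho$. $\Phi$ is the set of all causal policies. For $n\in\mathbb{N}$, the threshold policy $n$ takes action $0$ in states $b^j$ with $j<n$ and action $1$ in states $b^j$ with $j\ge n$. For each $W\ge0$ the problem admits an optimal policy of threshold type. $D(W)$ is the set of states in which the passive action is optimal with respect to the optimal (threshold) solution: $b^j\in D(W)$ if and only if there is a threshold policy $n$, optimal for the problem with parameter $W$ for every initial state, which prescribes the passive action in $b^j$ (i.e. $j<n$). *)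

(* Defs.v *)
From HB Require Import structures.
From mathcomp Require Import all_boot all_order all_algebra.
From mathcomp Require Import all_classical all_reals all_analysis.

Set Implicit Arguments.
Unset Strict Implicit.
Unset Printing Implicit Defensive.

Import Order.TTheory GRing.Theory Num.Theory.
Import numFieldNormedType.Exports.

Local Open Scope classical_set_scope.
Local Open Scope ring_scope.

(* The state b^j is represented by its index j : nat (the values b^j are
   pairwise distinct when d, p > 0); the action is a bool, true = active. *)

Definition state_value (R : realType) (d p : R) (j : nat) : R :=
  d * p * (j * j.+1)%N%:R / 2.

Definition trans (R : realType) (rho : R) (j : nat) (a : bool) (k : nat) : R :=
  if a then rho * (k == 0%N)%:R + (1 - rho) * (k == j.+1)%:R
  else (k == j.+1)%:R.

(* History-dependent, possibly randomized, policies: [phi h j] is the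
   probability of choosing the active action in the current state j, given the
   past state-action pairs h, oldest first. *)
Record policy (R : realType) := Policy {
  active_prob :> seq (nat * bool) -> nat -> R ;
  active_prob01 : forall h j, 0 <= active_prob h j <= 1 }.

Definition action_prob (R : realType) (phi : policy R)
    (h : seq (nat * bool)) (j : nat) (a : bool) : R :=
  if a then phi h j else 1 - phi h j.

(* Probability that the next [size w] state-action pairs are w, when the past
   ones are h and the current state has conditional law mu. *)
Fixpoint path_prob (R : realType) (rho : R) (phi : policy R)
    (h : seq (nat * bool)) (mu : nat -> R) (w : seq (nat * bool)) : R :=
  if w is (j, a) :: w' then
    mu j * action_prob phi h j a
      * path_prob rho phi (rcons h (j, a)) (trans rho j a) w'
  else 1.

Definition traj_prob (R : realType) (rho : R) (phi : policy R) (i : nat)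
    (w : seq (nat * bool)) : R :=
  path_prob rho phi [::] (fun j => (j == i)%:R) w.

Definition total_cost (R : realType) (d p W : R) (w : seq (nat * bool)) : R :=
  \sum_(x <- w) (state_value d p x.1 + W * (x.2)%:R).

(* The law of (s(t), a(t))_{t < T} is discrete, so the expectation is a sum
   over trajectories of length T. *)
Definition expected_cost (R : realType) (d p rho W : R) (phi : policy R)
    (i T : nat) : \bar R :=
  \esum_(w in [set w : seq (nat * bool) | size w = T])
    (traj_prob rho phi i w * total_cost d p W w)%:E.

Definition average_cost (R : realType) (d p rho W : R) (phi : policy R)
    (i : nat) : \bar R :=
  limn_esup (fun T : nat =>
    ((T%:R^-1)%:E * expected_cost d p rho W phi i T)%E).

Definition optimal (R : realType) (d p rho W : R) (phi : policy R) : Prop :=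
  forall (i : nat) (psi : policy R),
    (average_cost d p rho W phi i <= average_cost d p rho W psi i)%E.

Lemma threshold_prob01 (R : realType) (n : nat) (h : seq (nat * bool))
    (j : nat) : 0 <= ((n <= j)%N%:R : R) <= 1.
Proof. by case: (n <= j)%N; rewrite /= ?lexx ?ler01. Qed.

Definition threshold (R : realType) (n : nat) : policy R :=
  Policy (@threshold_prob01 R n).

Definition passive_set (R : realType) (d p rho W : R) : set nat :=
  [set j | exists2 n : nat, optimal d p rho W (threshold R n) & (j < n)%N].

Definition indexable (R : realType) (d p rho : R) : Prop :=
  forall W1 W2 : R, 0 <= W1 -> W1 <= W2 ->
    passive_set d p rho W1 `<=` passive_set d p rho W2.

(* Main.v *)
(** Let [s_j] be the value of [b^j]. The average cost of the
    threshold policy [n] is the renewal ratio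
    [cycle_cost n = (E (state costs of a cycle) + W / rho) / (n + 1 / rho)],
    cycles being delimited by the visits to [b^0]. Under the threshold [n] the
    relative values [u_n] are explicit: partial sums of [cycle_cost n - s_k] up
    to [n], a quadratic polynomial [F] beyond. If [n] minimizes [cycle_cost], then
    [u_n] solves the average-cost optimality equation, because
    [(m + 1 / rho) * (cycle_cost m - cycle_cost n)] has increments
    [rho * F(m + 1) - W] and [F] is increasing.
    As [cycle_cost] tends to infinity it has a minimum, so that the optimal
    thresholds are exactly its minimizers.
    Finally [W] enters [cycle_cost n] through the term [W / (rho * n + 1)],
    which decreases with [n], hence minimizers move to the right as [W] grows. *)

Require Import Defs.
From mathcomp Require Import all_boot all_order all_algebra.
From mathcomp Require Import all_classical all_reals all_analysis.
From mathcomp Require Import ring lra.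
Import Order.TTheory GRing.Theory Num.Theory.
Local Open Scope classical_set_scope.
Local Open Scope ring_scope.
Set Implicit Arguments.
Unset Strict Implicit.
Unset Printing Implicit Defensive.

(** * Nonnegative sums over trajectories *)

Lemma ge0_esumZl (R : realType) (T : choiceType) (S : set T) (r : R)
    (f : T -> \bar R) : 0 <= r -> (forall x, 0 <= f x)%E ->
  \esum_(x in S) (r%:E * f x)%E = (r%:E * \esum_(x in S) f x)%E.
Proof.
move=> r0 f0; rewrite /esum -ereal_supZl//; last first.
  apply/set0P; exists (\sum_(x \in set0) f x)%E.
  by exists set0 => //; exact: fsets_set0.
congr ereal_sup; rewrite image_comp; apply: eq_imagel => A _ /=.
by rewrite ge0_mule_fsumr.
Qed.

Lemma esum_size_cons (R : realType) (T : choiceType) (n : nat)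
    (f : seq T -> \bar R) : (forall w, 0 <= f w)%E ->
  \esum_(w in [set w | size w = n.+1]) f w =
  \esum_(x in [set: T]) \esum_(w in [set w | size w = n]) f (x :: w).
Proof.
move=> f0; rewrite esum_esum//.
rewrite (@reindex_esum _ _ _ ([set: T] `*`` (fun=> [set w | size w = n]))
  _ (fun k => k.1 :: k.2))//; split.
- by move=> [x w] /= [_ ->].
- by move=> [x w] [y v] _ _ /= [-> ->].
- by move=> [|x w] //= [wn]; exists (x, w).
Qed.

Lemma esum_pred2 (R : realType) (T : choiceType) (x y : T) (f : T -> \bar R) :
  x != y -> (forall z, 0 <= f z)%E -> (forall z, z != x -> z != y -> f z = 0%E) ->
  \esum_(z in setT) f z = (f x + f y)%E.
Proof.
move=> xy f0 fN.
rewrite (esumID [set x])// setTI esum_set1//; congr (_ + _)%E.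
rewrite (esumID [set y])// setTI.
rewrite (_ : ~` [set x] `&` [set y] = [set y])%classic; last first.
  by apply/seteqP; split=> [z []//|z /= ->]; split=> // yx; rewrite yx eqxx in xy.
rewrite esum_set1// esum1 ?adde0// => z [/= /eqP zx /eqP zy].
exact: fN.
Qed.

(** * Finite-horizon costs and verification inequalities *)

Section cost_to_go.
Context {R : realType} (d p rho W : R)
  (rho01 : 0 < rho <= 1) (d0 : 0 < d) (p0 : 0 < p) (W0 : 0 <= W).

Lemma state_value_ge0 j : 0 <= state_value d p j.
Proof. by rewrite /state_value !mulr_ge0 ?invr_ge0// ltW. Qed.

Definition stage_cost (j : nat) (a : bool) : R := state_value d p j + W * a%:R.

Lemma stage_cost_ge0 j a : 0 <= stage_cost j a.
Proof. by rewrite addr_ge0 ?state_value_ge0// mulr_ge0. Qed.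

Definition next_mean (u : nat -> R) (j : nat) (a : bool) : R :=
  if a then rho * u 0%N + (1 - rho) * u j.+1 else u j.+1.

(** Real-valued dynamic-programming form of the expected cost; each state has two possible
    successors at most, so no infinite sum is involved. *)
Fixpoint cost_to_go (phi : policy R) (h : seq (nat * bool)) (j T : nat) : R :=
  if T is T'.+1 then
    \sum_(a : bool) action_prob phi h j a *
      (stage_cost j a
       + next_mean (fun k => cost_to_go phi (rcons h (j, a)) k T') j a)
  else 0.

Lemma action_prob_ge0 (phi : policy R) h j a : 0 <= action_prob phi h j a.
Proof.
by have /andP[? ?] := active_prob01 phi h j; case: a; rewrite /= ?subr_ge0.
Qed.

Lemma action_prob_mean_cst (phi : policy R) h j (x : R) :
  \sum_(a : bool) action_prob phi h j a * x = x.
Proof. by rewrite big_bool/=; ring. Qed.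

Lemma trans_ge0 j a k : 0 <= trans rho j a k.
Proof.
case/andP: rho01 => r0 r1.
by case: a; rewrite /= ?addr_ge0 ?mulr_ge0 ?subr_ge0// ltW.
Qed.

Lemma path_prob_ge0 phi h mu w : (forall j, 0 <= mu j) ->
  0 <= path_prob rho phi h mu w.
Proof.
elim: w h mu => [//|[j a] w IH] h mu mu0 /=.
by rewrite !mulr_ge0 ?action_prob_ge0// IH// => k; exact: trans_ge0.
Qed.

Lemma total_cost_ge0 w : 0 <= total_cost d p W w.
Proof. by apply: sumr_ge0 => x _; exact: stage_cost_ge0. Qed.

(** Path probabilities are linear in the initial law, so inductions can be confined to point
    masses. *)
Lemma path_prob_trans_active phi h j w :
  path_prob rho phi h (trans rho j true) w =
  rho * path_prob rho phi h (fun k => (k == 0%N)%:R) w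
  + (1 - rho) * path_prob rho phi h (fun k => (k == j.+1)%:R) w.
Proof. by case: w => [|[k b] w] /=; ring. Qed.

(** The offset [c] carries the cost already paid, so that the induction handles expected cost and
    total mass at once, with nonnegative terms throughout. *)
Lemma esum_path_prob phi h i T (c : R) : 0 <= c ->
  \esum_(w in [set w | size w = T])
    (path_prob rho phi h (fun j => (j == i)%:R) w * (c + total_cost d p W w))%:E
  = (c + cost_to_go phi h i T)%:E.
Proof.
elim: T h i c => [|T IH] h i c c0.
  rewrite (_ : [set w | size w = 0%N] = [set [::]])%classic; last first.
    by apply/seteqP; split=> [w /= /size0nil//|w /= ->].
  rewrite esum_set1 /total_cost big_nil/= addr0 mul1r ?addr0 ?lee_fin//.
have f0 h' (mu : nat -> R) c' w : 0 <= c' -> (forall j, 0 <= mu j) ->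
    (0 <= (path_prob rho phi h' mu w * (c' + total_cost d p W w))%:E)%E.
  move=> ? ?.
  by rewrite lee_fin mulr_ge0 ?path_prob_ge0// addr_ge0// total_cost_ge0.
rewrite esum_size_cons; last by move=> w; apply: f0.
(* Starting from the point mass at [i], only these two first pairs have positive weight. *)
rewrite (@esum_pred2 _ _ (i, true) (i, false))//; first last.
- move=> [j a] ja1 ja0; apply: esum1 => w _ /=.
  suff /negPf-> : j != i by rewrite !mul0r.
  by apply/eqP => ji; move: ja1 ja0; rewrite ji; case: (a); rewrite eqxx.
- by move=> z; apply: esum_ge0 => w _; apply: f0.
- by rewrite xpair_eqE andbF.
have step a : \esum_(w in [set w | size w = T])
    (path_prob rho phi h (fun j => (j == i)%:R) ((i, a) :: w) *
      (c + total_cost d p W ((i, a) :: w)))%:E =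
   (action_prob phi h i a * (c + stage_cost i a
     + next_mean (fun k => cost_to_go phi (rcons h (i, a)) k T) i a))%:E.
  have ca0 : 0 <= c + stage_cost i a by rewrite addr_ge0// stage_cost_ge0.
  transitivity ((action_prob phi h i a)%:E *
    \esum_(w in [set w | size w = T])
      (path_prob rho phi (rcons h (i, a)) (trans rho i a) w *
        (c + stage_cost i a + total_cost d p W w))%:E)%E.
    rewrite -ge0_esumZl ?action_prob_ge0//; last first.
      by move=> w; apply: f0 => // k; exact: trans_ge0.
    apply: eq_esum => w _.
    rewrite -EFinM /= eqxx mul1r /total_cost big_cons/= /stage_cost.
    by rewrite -mulrA !addrA.
  rewrite EFinM; congr (_ * _)%E.
  case: a ca0 => ca0 /=; last by rewrite -IH.
  under eq_esum => w _ do
    rewrite path_prob_trans_active mulrDl -!mulrA EFinD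
      !(EFinM rho, EFinM (1 - rho)).
  case/andP: rho01 => r0 r1.
  rewrite esumD; last 2 first.
  - by move=> w _; apply: mule_ge0; [rewrite lee_fin ltW|apply: f0].
  - by move=> w _; apply: mule_ge0; [rewrite lee_fin subr_ge0|apply: f0].
  rewrite !ge0_esumZl ?subr_ge0 ?(ltW r0)//; try by move=> w; apply: f0.
  by rewrite !IH// -!EFinM -EFinD; congr EFin; ring.
rewrite !step -EFinD /= big_bool/=; congr EFin.
by ring.
Qed.

Lemma expected_costE phi i T :
  expected_cost d p rho W phi i T = (cost_to_go phi [::] i T)%:E.
Proof.
rewrite /expected_cost /traj_prob -[cost_to_go _ _ _ _]add0r.
rewrite -(esum_path_prob phi [::] i T (lexx 0)).
by apply: eq_esum => w _; rewrite add0r.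
Qed.

Lemma next_meanD (u v : nat -> R) j a :
  next_mean (fun k => u k + v k) j a = next_mean u j a + next_mean v j a.
Proof. by case: a => //=; ring. Qed.

Lemma next_mean_cst (x : R) j a : next_mean (fun=> x) j a = x.
Proof. by case: a => //=; ring. Qed.

Lemma next_meanZ (x : R) (u : nat -> R) j a :
  next_mean (fun k => x * u k) j a = x * next_mean u j a.
Proof. by case: a => //=; ring. Qed.

Lemma le_next_mean (u v : nat -> R) j a : (forall k, u k <= v k) ->
  next_mean u j a <= next_mean v j a.
Proof.
case/andP: rho01 => ? ? uv; case: a => //=.
by rewrite lerD ?ler_wpM2l ?subr_ge0// ltW.
Qed.

(** Induction on the horizon: [u] telescopes, and its lower bound absorbs the terminal value. The
    inequality is asked only for actions that [phi] takes with nonzero probability. *)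
Lemma cost_to_go_le phi (g K : R) (u : nat -> R) :
    (forall h j a, action_prob phi h j a != 0 ->
      stage_cost j a + next_mean u j a <= g + u j) ->
    (forall j, - K <= u j) ->
  forall T h j, cost_to_go phi h j T <= T%:R * g + u j + K.
Proof.
move=> ug uK; elim=> [|T IH] h j; last rewrite -natr1 /=.
  by rewrite /= mul0r add0r -lerBlDr sub0r.
rewrite -[leRHS](action_prob_mean_cst phi h j).
apply: ler_sum => a _; have [->|ap0] := eqVneq (action_prob phi h j a) 0.
  by rewrite !mul0r.
rewrite ler_wpM2l ?action_prob_ge0//.
have H : next_mean (fun k => cost_to_go phi (rcons h (j, a)) k T) j a <=
    next_mean (fun k => u k + (T%:R * g + K)) j a.
  by apply: le_next_mean => k; have := IH (rcons h (j, a)) k; lra.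
rewrite next_meanD next_mean_cst in H.
by have := ug h j a ap0; lra.
Qed.

Lemma cost_to_go_ge phi (g K : R) (u : nat -> R) :
    (forall h j a, action_prob phi h j a != 0 ->
      g + u j <= stage_cost j a + next_mean u j a) ->
    (forall j, u j <= K) ->
  forall T h j, T%:R * g + u j - K <= cost_to_go phi h j T.
Proof.
move=> ug uK; elim=> [|T IH] h j; last rewrite -natr1 /=.
  by rewrite /= mul0r add0r subr_le0.
rewrite -[leLHS](action_prob_mean_cst phi h j).
apply: ler_sum => a _; have [->|ap0] := eqVneq (action_prob phi h j a) 0.
  by rewrite !mul0r.
rewrite ler_wpM2l ?action_prob_ge0//.
have H : next_mean (fun k => u k + (T%:R * g - K)) j a <=
    next_mean (fun k => cost_to_go phi (rcons h (j, a)) k T) j a.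
  by apply: le_next_mean => k; have := IH (rcons h (j, a)) k; lra.
rewrite next_meanD next_mean_cst in H.
by have := ug h j a ap0; lra.
Qed.

Lemma average_cost_le phi i (g K : R) :
  (forall T, cost_to_go phi [::] i T <= T%:R * g + K) ->
  (average_cost d p rho W phi i <= g%:E)%E.
Proof.
move=> H; apply/lee_addgt0Pr => e e0; rewrite /average_cost /limn_esup limf_esupE.
(* The bound is at least 1, which keeps [T] positive, and it forces [|K| / T] below [e]. *)
pose V := [set T : nat | (`|K| + e) / e <= T%:R].
apply: (@le_trans _ _ (ereal_sup [set ((T%:R^-1)%:E
    * expected_cost d p rho W phi i T)%E | T in V])).
  by apply: ereal_inf_lbound; exists V => //; exact: nbhs_infty_ger.
apply: ge_ereal_sup => _ [T TV <-].
rewrite expected_costE -EFinM -EFinD lee_fin.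
have T0 : 0 < T%:R :> R.
  by apply: lt_le_trans TV; rewrite divr_gt0// ltr_wpDl.
rewrite ler_pdivrMl//; apply: le_trans (H T) _.
rewrite mulrDr lerD2l; move: TV; rewrite /V/= ler_pdivrMr// => TV.
by rewrite (le_trans (ler_norm K))//; lra.
Qed.

(** Allowing [K] to depend on [e] leaves room for a truncation level that depends on [e]; half of
    the final slack absorbs [K / T]. *)
Lemma average_cost_ge phi i (g : R) :
  (forall e, 0 < e -> exists K, forall T,
    T%:R * (g - e) - K <= cost_to_go phi [::] i T) ->
  (g%:E <= average_cost d p rho W phi i)%E.
Proof.
move=> H; apply/lee_subgt0Pr => e e0; rewrite /average_cost /limn_esup limf_esupE.
have e20 : 0 < e / 2 by rewrite divr_gt0.
have [K HK] := H _ e20.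
apply: le_ereal_inf_tmp => _ [V Voo <-].
have : \forall T \near \oo, (`|K| + e) / (e / 2) <= T%:R by exact: nbhs_infty_ger.
move=> KT; have [T [TV KTT]] := filter_ex (filterI Voo KT).
apply: le_ereal_sup_tmp; eexists; first by exists T.
rewrite expected_costE -EFinM -EFinB lee_fin.
have T0 : 0 < T%:R :> R.
  by apply: lt_le_trans KTT; rewrite divr_gt0// ltr_wpDl.
rewrite ler_pdivlMl//; apply: le_trans (HK T).
move: KTT; rewrite ler_pdivrMr// => KTT.
by have := ler_norm K; lra.
Qed.

End cost_to_go.

(** * Lower bounds from relative values of quadratic growth *)

Lemma bounded_prefix (R : realType) (u : nat -> R) (N : nat) :
  exists K, forall k, (k <= N)%N -> `|u k| <= K.
Proof.
exists (\sum_(k < N.+1) `|u k|) => k kN.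
by rewrite (bigD1 (Ordinal (kN : (k < N.+1)%N)))//= lerDl sumr_ge0.
Qed.

Section relative_value_bound.
Context {R : realType} (d p rho W : R)
  (rho01 : 0 < rho <= 1) (d0 : 0 < d) (p0 : 0 < p) (W0 : 0 <= W).

Let c := d * p / 2.

Let c_gt0 : 0 < c.
Proof. by rewrite /c divr_gt0// mulr_gt0. Qed.

Lemma state_valueE j : state_value d p j = c * (j%:R * (j%:R + 1)).
Proof. by rewrite /state_value /c natrM -natr1; ring. Qed.

Lemma state_value_homo : {homo state_value d p : j k / (j <= k)%N >-> j <= k}.
Proof.
move=> j k jk; rewrite /state_value ler_wpM2r ?invr_ge0//.
by rewrite ler_wpM2l ?ler_nat ?leq_mul// mulr_ge0// ltW.
Qed.

(* [u] may grow quadratically, so it is frozen beyond a level [N]; scaling by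
   [theta < 1] frees a quadratic part [(1 - theta) * state_value d p N] of the
   cost, which absorbs the linear error made at the states beyond [N]. *)
Lemma average_cost_ge_relative (phi : policy R) (adm : nat -> bool -> bool)
    (m : nat) (g D : R) (u : nat -> R) :
    0 <= g -> 0 <= D -> u 0%N = 0 ->
    (forall h j a, action_prob phi h j a != 0 -> adm j a) ->
    (forall j a, adm j a -> g + u j <= stage_cost d p W j a + next_mean rho u j a) ->
    (forall j, (m <= j)%N -> adm j true) ->
    (forall j, (m <= j)%N -> u j.+1 - u j <= D * j.+1%:R) ->
  forall i, (g%:E <= average_cost d p rho W phi i)%E.
Proof.
move=> g0 D0 u0 phi_adm adm_u adm_true uD i.
apply: average_cost_ge => // e e0.
have ge1 : 0 < g + e + 1 by lra.
(* Chosen so that [(1 - theta) * g <= e]: the scaling costs at most [e] per stage. *)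
pose theta := 1 - e / (g + e + 1).
have th1 : 0 < 1 - theta by rewrite /theta opprB addrC subrK divr_gt0.
have th0 : 0 <= theta.
  by rewrite /theta subr_ge0 ler_pdivrMr//; lra.
have thg : g - e <= theta * g.
  rewrite /theta mulrBl mul1r lerD2l lerN2 mulrAC ler_pdivrMr//.
  by rewrite ler_wpM2l ?(ltW e0)//; lra.
pose M := (D + g) / ((1 - theta) * c).
have den0 : 0 < (1 - theta) * c by rewrite mulr_gt0.
(* Large enough for [D + g <= (1 - theta) * c * N]. Hence the freed cost at [N] dominates
   [D * (N + 1)], and the state value at [N] is at least [g]. *)
pose N := (m + (Num.bound M).+1)%N.
have mN : (m <= N)%N by rewrite leq_addr.
have DN : D + g <= (1 - theta) * c * N%:R.
  rewrite mulrC -ler_pdivrMr//.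
  have M0 : 0 <= M by rewrite divr_ge0// ?addr_ge0// ltW.
  apply: (le_trans (ltW (archi_boundP M0))).
  by rewrite ler_nat /N addnS ltnW// ltnS leq_addl.
have N0 : 1 <= N%:R :> R by rewrite ler1n /N addnS.
have sN : state_value d p N = c * (N%:R * (N%:R + 1)) := state_valueE N.
have gN : g <= state_value d p N.
  have : (1 - theta) * c * N%:R <= c * N%:R.
    by rewrite -mulrA ler_piMl ?gerBl// mulr_ge0// ltW.
  by rewrite sN; nra.
have [K uK] := bounded_prefix u N.
pose v j := theta * u (minn j N).
exists (K - theta * u (minn i N)) => T.
have K0 : 0 <= K by apply: le_trans (uK 0%N _).
suff H : T%:R * (theta * g) + v i - K <= cost_to_go d p rho W phi [::] i T.
  apply: le_trans H; rewrite opprB addrA addrAC -/(v i) addrAC lerD2r lerD2r.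
  by rewrite ler_wpM2l.
apply: cost_to_go_ge => // [h j a /phi_adm ja|j]; last first.
  rewrite /v; have := uK (minn j N) (geq_minr _ _); have := ler_norm (u (minn j N)).
  by nra.
have s0 := stage_cost_ge0 d0 p0 W0 j a.
rewrite /v next_meanZ.
have [jN|Nj] := ltnP j N.
  have -> : next_mean rho (fun k => u (minn k N)) j a = next_mean rho u j a.
    by rewrite /next_mean min0n (minn_idPl jN).
  by have := adm_u j a ja; nra.
rewrite /next_mean min0n (minn_idPr (leqW Nj)) u0 mulr0 add0r.
have sj : state_value d p N <= state_value d p j := state_value_homo Nj.
case: a ja s0 => _ _; rewrite /stage_cost /= ?mulr1 ?mulr0 ?addr0; last by nra.
(* Beyond [N] the active case reduces to [theta * (g + rho * u N) <= s_j + W]. The inequality at [N]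
   gives this up to the error [(1 - rho) * (u N.+1 - u N)]. *)
have := adm_u N true (adm_true _ mN).
rewrite /stage_cost /= u0 mulr0 add0r mulr1 => HN.
have := uD N mN; rewrite -natr1 => HD.
case/andP: rho01 => r0 r1.
have HD2 : (1 - rho) * (u N.+1 - u N) <= D * (N%:R + 1).
  have : 0 <= D * (N%:R + 1) by rewrite mulr_ge0// addr_ge0.
  by nra.
have HD3 : D * (N%:R + 1) <= (1 - theta) * state_value d p N.
  rewrite sN; have : D <= (1 - theta) * c * N%:R by lra.
  by nra.
have X0 : 0 <= D * (N%:R + 1) by rewrite mulr_ge0// addr_ge0.
have HX : theta * (state_value d p N + W + D * (N%:R + 1)) <= state_value d p N + W.
  have := mulr_ge0 (ltW th1) X0; have := mulr_ge0 (ltW th1) W0.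
  by move: HD3; rewrite !mulrBl !mul1r !mulrDr; lra.
have : theta * (g + rho * u N) <= theta * (state_value d p N + W + D * (N%:R + 1)).
  by rewrite ler_wpM2l//; lra.
by rewrite !(mulrDr theta) !mulrBl mul1r in HX *; lra.
Qed.

End relative_value_bound.

(** * Threshold policies and the optimality equation *)

Section threshold_cost.
Context {R : realType} (d p rho W : R)
  (rho01 : 0 < rho <= 1) (d0 : 0 < d) (p0 : 0 < p) (W0 : 0 <= W).

Let c := d * p / 2.
(** [alpha] and [beta] come from matching the quadratic and linear coefficients in the recursion of
    [active_value_step]. *)
Let alpha := c / rho.
Let beta := (c + 2 * (1 - rho) * alpha) / rho.

Let c_gt0 : 0 < c.
Proof. by rewrite /c divr_gt0// mulr_gt0. Qed.

Let rho_gt0 : 0 < rho. Proof. by case/andP: rho01. Qed.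

Let rho_le1 : rho <= 1. Proof. by case/andP: rho01. Qed.

Let alpha_gt0 : 0 < alpha. Proof. by rewrite divr_gt0. Qed.

Let beta_gt0 : 0 < beta.
Proof.
rewrite divr_gt0// ltr_pwDl//; apply: mulr_ge0; last exact: ltW.
by rewrite mulr_ge0 ?subr_ge0.
Qed.

(* Expected sum of the state values from [j] until the first successful
   activation, the active action being always taken. *)
Definition active_value (j : nat) : R :=
  alpha * j%:R ^+ 2 + beta * j%:R + (1 - rho) * (alpha + beta) / rho.

Lemma active_value_step j :
  active_value j = state_value d p j + (1 - rho) * active_value j.+1.
Proof.
rewrite state_valueE /active_value -natr1 /beta /alpha -/c; field.
by rewrite gt_eqF.
Qed.

Lemma active_value_incr j :
  active_value j.+1 - active_value j = alpha * (2 * j%:R + 1) + beta.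
Proof. by rewrite /active_value -natr1; ring. Qed.

Lemma active_value_ge0 j : 0 <= active_value j.
Proof.
have [? ?] := (ltW alpha_gt0, ltW beta_gt0).
apply: addr_ge0; first by apply: addr_ge0; apply: mulr_ge0.
by rewrite divr_ge0 ?(ltW rho_gt0)// mulr_ge0 ?subr_ge0// addr_ge0.
Qed.

Lemma active_value_homo : {homo active_value : j k / (j <= k)%N >-> j <= k}.
Proof.
apply: homo_leq => [//|y x z|j]; first exact: le_trans.
rewrite -subr_ge0 active_value_incr.
apply: addr_ge0; last exact: ltW.
by apply: mulr_ge0; [exact: ltW|rewrite addr_ge0].
Qed.

Definition passive_value (m : nat) : R := \sum_(k < m) state_value d p k.

Lemma passive_value_ge0 m : 0 <= passive_value m.
Proof. by apply: sumr_ge0 => k _; exact: state_value_ge0. Qed.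

(* Expected cost over expected length of a cycle between two visits to [b^0]
   under the threshold policy [m]. *)
Definition cycle_cost (m : nat) : R :=
  (passive_value m + active_value m + W / rho) / (m%:R + rho^-1).

Lemma cycle_length_gt0 (m : nat) : 0 < m%:R + rho^-1.
Proof. by rewrite ltr_wpDl// invr_gt0. Qed.

Lemma cycle_cost_ge0 m : 0 <= cycle_cost m.
Proof.
apply: divr_ge0; last exact: ltW (cycle_length_gt0 _).
apply: addr_ge0; last by apply: divr_ge0 => //; exact: ltW.
by apply: addr_ge0; [exact: passive_value_ge0|exact: active_value_ge0].
Qed.

(* With [g] the cost per stage, [active_rel g j] and [passive_rel g j] are the
   relative values of [b^j], normalized at [b^0], in the active and in the
   passive zone. *)
Definition active_rel (g : R) (j : nat) : R := active_value j + (W - g) / rho.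
Definition passive_rel (g : R) (j : nat) : R := j%:R * g - passive_value j.

Lemma active_rel_step g j :
  active_rel g j = state_value d p j + W - g + (1 - rho) * active_rel g j.+1.
Proof.
rewrite /active_rel (active_value_step j); field.
by rewrite gt_eqF.
Qed.

Lemma active_rel_homo g : {homo active_rel g : j k / (j <= k)%N >-> j <= k}.
Proof. by move=> j k jk; rewrite lerD2r active_value_homo. Qed.

Lemma passive_rel_step g j :
  passive_rel g j.+1 = passive_rel g j + g - state_value d p j.
Proof. by rewrite /passive_rel /passive_value big_ord_recr/= -natr1; ring. Qed.

(** At [g = cycle_cost m] the gap vanishes, which glues the two branches of [relative_value];
    otherwise its sign compares [cycle_cost m] with [g]. *)
Lemma rel_gap g m :
  active_rel g m - passive_rel g m = (m%:R + rho^-1) * (cycle_cost m - g).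
Proof.
rewrite /cycle_cost mulrBr mulrCA divff ?gt_eqF ?cycle_length_gt0// mulr1.
by rewrite /active_rel /passive_rel; ring.
Qed.

Lemma rel_gap_incr g m :
  (active_rel g m.+1 - passive_rel g m.+1) - (active_rel g m - passive_rel g m)
  = rho * active_rel g m.+1 - W.
Proof. by rewrite passive_rel_step (active_rel_step g m); ring. Qed.

(** The passive branch includes [j = n], so that the passive recursion applies at every [j < n];
    both branches agree at [n]. *)
Definition relative_value (n j : nat) : R :=
  if (j <= n)%N then passive_rel (cycle_cost n) j else active_rel (cycle_cost n) j.

Lemma relative_value0 n : relative_value n 0 = 0.
Proof. by rewrite /relative_value /passive_rel /passive_value big_ord0 mul0r subr0. Qed.

Lemma relative_value_passive n j : (j < n)%N ->
  cycle_cost n + relative_value n j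
  = stage_cost d p W j false + next_mean rho (relative_value n) j false.
Proof.
move=> jn; rewrite /next_mean /relative_value jn (ltnW jn) passive_rel_step.
by rewrite /stage_cost /=; ring.
Qed.

Lemma relative_value_activeE n j : (n <= j)%N ->
  relative_value n j = active_rel (cycle_cost n) j.
Proof.
rewrite /relative_value leq_eqVlt => /predU1P[<-|]; last by rewrite ltnNge => /negPf->.
by rewrite leqnn; apply/esym/eqP; rewrite -subr_eq0 rel_gap subrr mulr0.
Qed.

Lemma relative_value_active n j : (n <= j)%N ->
  cycle_cost n + relative_value n j
  = stage_cost d p W j true + next_mean rho (relative_value n) j true.
Proof.
move=> nj; rewrite /next_mean relative_value0 !relative_value_activeE ?leqW//.
by rewrite (active_rel_step _ j) /stage_cost /=; ring.
Qed.

Lemma relative_value_incr n j : (n <= j)%N ->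
  relative_value n j.+1 - relative_value n j <= (2 * alpha + beta) * j.+1%:R.
Proof.
move=> nj; rewrite !relative_value_activeE ?leqW// /active_rel.
rewrite opprD addrACA subrr addr0 active_value_incr -natr1.
by have := mulr_ge0 (ltW beta_gt0) (ler0n R j); have := alpha_gt0; lra.
Qed.

Lemma relative_value_ge n : exists K, forall j, - K <= relative_value n j.
Proof.
have [K uK] := bounded_prefix (relative_value n) n; exists K => j.
have lek k : (k <= n)%N -> - K <= relative_value n k.
  by move=> kn; rewrite lerNl (le_trans (ler_norm _))// normrN uK.
have [/lek//|/ltnW nj] := leqP j n; apply: le_trans (lek n (leqnn n)) _.
by rewrite !relative_value_activeE// active_rel_homo.
Qed.

(** [relative_value n] satisfies the evaluation equation of the policy with equality. It is bounded
    below, which gives the upper bound directly; its growth is why the lower bound goes through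
    truncation. *)
Lemma average_cost_threshold n i :
  average_cost d p rho W (threshold R n) i = (cycle_cost n)%:E.
Proof.
have adm h j a : action_prob (threshold R n) h j a != 0 -> a == (n <= j)%N.
  by case: a => /=; case: (n <= j)%N => //=; rewrite ?eqxx// subrr eqxx.
have acoe j a : a == (n <= j)%N -> cycle_cost n + relative_value n j
    = stage_cost d p W j a + next_mean rho (relative_value n) j a.
  move=> /eqP->; case: leqP => [nj|jn].
    exact: relative_value_active.
  exact: relative_value_passive.
apply/eqP; rewrite eq_le; apply/andP; split.
  have [K uK] := relative_value_ge n.
  apply: (average_cost_le rho01 d0 p0 W0 (K := relative_value n i + K)).
  move=> T; rewrite addrA; apply: cost_to_go_le => // h j a /adm/acoe <-.
  exact: lexx.
apply: (average_cost_ge_relative rho01 d0 p0 W0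
  (adm := fun j a => a == (n <= j)%N) (m := n) (D := 2 * alpha + beta)
  (u := relative_value n)) => //.
- exact: cycle_cost_ge0.
- apply: addr_ge0; last exact: ltW.
  by apply: mulr_ge0; last exact: ltW.
- exact: relative_value0.
- by move=> j a /acoe ->.
- exact: relative_value_incr.
Qed.

(** Minimality makes the gap nonnegative everywhere and zero at [n], which fixes the sign of its
    increments next to [n]; monotonicity of [active_rel] spreads these signs to all states. *)
Lemma cycle_cost_min_le n psi i : (forall m, cycle_cost n <= cycle_cost m) ->
  ((cycle_cost n)%:E <= average_cost d p rho W psi i)%E.
Proof.
move=> nmin; set g := cycle_cost n.
have gap0 m : 0 <= active_rel g m - passive_rel g m.
  by rewrite rel_gap mulr_ge0 ?subr_ge0// ltW// cycle_length_gt0.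
have gapn : active_rel g n - passive_rel g n = 0 by rewrite rel_gap subrr mulr0.
have le_before m : (m < n)%N -> rho * active_rel g m.+1 <= W.
  move=> mn; apply: (@le_trans _ _ (rho * active_rel g n)).
    by rewrite ler_pM2l// active_rel_homo.
  have := rel_gap_incr g n.-1; have := gap0 n.-1.
  by rewrite (ltn_predK mn); lra.
have ge_after m : (n <= m)%N -> W <= rho * active_rel g m.+1.
  move=> nm; apply: (@le_trans _ _ (rho * active_rel g n.+1)).
    by have := rel_gap_incr g n; have := gap0 n.+1; lra.
  by rewrite ler_pM2l// active_rel_homo.
apply: (average_cost_ge_relative rho01 d0 p0 W0
  (adm := fun _ _ => true) (m := n) (D := 2 * alpha + beta)
  (u := relative_value n)) => //.
- exact: cycle_cost_ge0.
- apply: addr_ge0; last exact: ltW.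
  by apply: mulr_ge0; last exact: ltW.
- exact: relative_value0.
(* The passive side exceeds the active side by [rho * relative_value n j.+1 - W], so only its sign
   on each side of [n] matters. *)
- move=> j a _; have [jn|nj] := ltnP j n.
    rewrite relative_value_passive//; case: a => //.
    have le_rel : rho * relative_value n j.+1 <= W.
      apply: le_trans (le_before j jn); rewrite ler_pM2l//.
      by rewrite /relative_value jn -subr_ge0; exact: gap0.
    by rewrite /stage_cost /next_mean relative_value0 /=; lra.
  rewrite relative_value_active//; case: a => //.
  rewrite /stage_cost /next_mean relative_value0 /=.
  rewrite relative_value_activeE ?leqW//.
  by have := ge_after j nj; rewrite -/g; lra.
- exact: relative_value_incr.
Qed.

Lemma ex_cycle_cost_min : exists n, forall m, cycle_cost n <= cycle_cost m.
Proof.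
have [M HM] : exists M, forall m, (M <= m)%N -> cycle_cost 0 <= cycle_cost m.
  set g := cycle_cost 0.
  have g0 : 0 <= g := cycle_cost_ge0 0.
  (* For [m >= 1] the cycle length is at most [(1 + rho^-1) * m], while the cycle's cost is at least
     [alpha * m ^ 2]; the ratio is thus at least [g] once [m >= B]. *)
  pose B := g * (1 + rho^-1) / alpha.
  have B0 : 0 <= B.
    apply: divr_ge0; last exact: ltW.
    by rewrite mulr_ge0// addr_ge0// invr_ge0 ltW.
  exists (Num.bound B).+1 => m Bm.
  have m1 : 1 <= m%:R :> R by rewrite ler1n (leq_ltn_trans _ Bm).
  have {}Bm : B <= m%:R.
    by rewrite (le_trans (ltW (archi_boundP B0)))// ler_nat ltnW.
  rewrite /cycle_cost ler_pdivlMr ?cycle_length_gt0//.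
  have BE : g * (1 + rho^-1) = B * alpha by rewrite divfK// gt_eqF.
  have le1 : g * (m%:R + rho^-1) <= g * (1 + rho^-1) * m%:R.
    rewrite -mulrA ler_wpM2l// mulrDl mul1r lerD2l ler_peMr// invr_ge0.
    exact: ltW.
  have le2 : g * (1 + rho^-1) * m%:R <= alpha * m%:R ^+ 2.
    by rewrite BE expr2 mulrA ler_wpM2r// mulrC ler_wpM2l// ltW.
  apply: le_trans le1 (le_trans le2 _).
  rewrite addrAC ler_wpDl//.
    by apply: addr_ge0; [exact: passive_value_ge0|rewrite divr_ge0// ltW].
  rewrite /active_value -addrA lerDl; apply: addr_ge0.
    by apply: mulr_ge0 => //; exact: ltW.
  apply: divr_ge0; last exact: ltW.
  by apply: mulr_ge0; rewrite ?subr_ge0// addr_ge0// ltW.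
case: (@arg_minP _ _ 'I_M.+1 ord0 xpredT (fun i : 'I_M.+1 => cycle_cost i)) => //.
move=> i _ imin; exists i => m; have [mM|Mm] := ltnP m M.+1.
  exact: (imin (Ordinal mM)).
by apply: le_trans (imin ord0 isT) (HM _ (ltnW Mm)).
Qed.

End threshold_cost.

(** * Monotonicity of the minimizers in the activation charge *)

Lemma cycle_cost_shift (R : realType) (d p rho W1 W2 : R) n : 0 < rho ->
  cycle_cost d p rho W2 n = cycle_cost d p rho W1 n + (W2 - W1) / (rho * n%:R + 1).
Proof.
move=> r0; rewrite /cycle_cost.
set x := passive_value _ _ n + _.
have nz : n%:R + rho^-1 != 0 by rewrite gt_eqF// ltr_wpDl// invr_gt0.
have nz2 : rho * n%:R + 1 != 0 by rewrite gt_eqF// ltr_wpDl// mulr_ge0// ltW.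
by field; rewrite nz2 gt_eqF.
Qed.

(** Exchange argument: adding the two inequalities cancels the costs at [W1] and leaves only the
    shifts, which decrease strictly in the threshold. *)
Lemma cycle_cost_min_homo (R : realType) (d p rho W1 W2 : R) (n1 n2 : nat) :
  0 < rho -> W1 < W2 ->
  cycle_cost d p rho W1 n1 <= cycle_cost d p rho W1 n2 ->
  cycle_cost d p rho W2 n2 <= cycle_cost d p rho W2 n1 -> (n1 <= n2)%N.
Proof.
move=> r0 W12 le1; rewrite !(@cycle_cost_shift _ _ _ _ W1 W2)// => le2.
have : (W2 - W1) / (rho * n2%:R + 1) <= (W2 - W1) / (rho * n1%:R + 1) by lra.
have pos n : 0 < rho * n%:R + 1 by rewrite ltr_wpDl// mulr_ge0// ltW.
by rewrite ler_pM2l ?subr_gt0// lef_pV2 ?posrE// lerD2r ler_pM2l// ler_nat.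
Qed.

Theorem proposition4 (R : realType) (d p rho : R)
    (hd : 0 < d) (hp : 0 < p <= 1) (hrho : 0 < rho <= 1) :
  indexable d p rho.
Proof.
move=> W1 W2 W10; have /andP[p0 _] := hp; have /andP[r0 _] := hrho.
rewrite le_eqVlt => /predU1P[<- //|W12] j [n1 opt1 jn1].
have W20 : 0 <= W2 := le_trans W10 (ltW W12).
have [n2 min2] := ex_cycle_cost_min hrho hd p0 W20.
exists n2.
  move=> i psi; rewrite average_cost_threshold//.
  exact: cycle_cost_min_le.
apply: leq_trans jn1 (cycle_cost_min_homo r0 W12 _ (min2 n1)).
(* Threshold costs do not depend on the initial state, so testing optimality of [n1] against [n2]
   from [b^0] suffices. *)
by have := opt1 0%N (threshold R n2); rewrite !average_cost_threshold.
Qed.
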